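(* Let $\lambda\ge 2$ and $\kappa\ge 1$ be cardinal numbers. Then ${\sf D}(\lambda,\kappa)$ implies ${\sf B}(\lambda,\kappa)$.
   Context: Multiboard Gale-Stewart game: for cardinals $\lambda\ge 2$, $\kappa\ge 1$ and a set $A\subseteq{}^{\omega}\lambda$, the game ${\sf GS}_{\lambda}(A,\kappa)$ has one inning per $n<\omega$. In inning $n$ player ONE first selects a function $f_{2n}\in{}^{\kappa}\lambda$, then player TWO responds with a function $f_{2n+1}\in{}^{\kappa}\lambda$. ONE wins the play $(f_n:n<\omega)$ if there is an $\alpha<\kappa$ with $(f_n(\alpha):n<\omega)\in A$; otherwise TWO wins. Strategies are perfect-information strategies, and a game is determined if one of the two players has a winning strategy. ${\sf D}(\lambda,\kappa)$ is the statement: for each set $A\subseteq{}^{\omega}\lambda$ the game ${\sf GS}_{\lambda}(A,\kappa)$ is determined. A space is Baire if the intersection of any countable collection of dense open subsets is dense. In the Banach-Mazur game ${\sf BM}(X)$ on a topological space $X$, White chooses a nonempty open $B_0\subseteq X$, Black a nonempty open $B_1\subseteq B_0$, White a nonempty open $B_2\subseteq B_1$, and so on, for $\omega$ innings; White wins if $\bigcap_{n<\omega}B_n=\emptyset$, and Black wins otherwise. A $\pi$-base of $X$ is a family $\mathcal{B}$ of nonempty open subsets of $X$ such that every nonempty open subset of $X$ includes a member of $\mathcal{B}$; the $\pi$-weight $\pi(X)$ is the minimal cardinality of a $\pi$-base of $X$. ${\sf B}(\lambda,\kappa)$ is the statement: if $X$ is a space with $\pi(X)\le\lambda$ and the power $X^{\kappa}$,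 considered in the box product topology, is Baire, then Black has a winning strategy in ${\sf BM}(X)$. The base theory is {\sf ZFC}. *)

(* Defs.v *)
(* MathComp-Analysis.  A cardinal is represented by a type of that
   cardinality. *)
From HB Require Import structures.
From mathcomp Require Import all_boot.
From mathcomp Require Import boolp classical_sets functions cardinality.
From mathcomp Require Import topology_structure.

Set Implicit Arguments.
Unset Strict Implicit.
Unset Printing Implicit Defensive.

Local Open Scope classical_set_scope.
Local Open Scope card_scope.

(* A play is the sequence f of all moves, ONE's moves being the f (2n) and
   TWO's the f (2n+1); [mkseq f m] is the position reached after m moves.  A
   strategy maps positions to moves. *)
Section GaleStewart.
Variables (L K : Type) (A : set (nat -> L)).

Definition GS_one_wins (f : nat -> K -> L) : Prop :=
  exists a : K, A (fun n => f n a).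

Definition GS_one_has_winning_strategy : Prop :=
  exists s : seq (K -> L) -> K -> L, forall f : nat -> K -> L,
    (forall n, f n.*2 = s (mkseq f n.*2)) -> GS_one_wins f.

Definition GS_two_has_winning_strategy : Prop :=
  exists s : seq (K -> L) -> K -> L, forall f : nat -> K -> L,
    (forall n, f n.*2.+1 = s (mkseq f n.*2.+1)) -> ~ GS_one_wins f.

Definition GS_determined : Prop :=
  GS_one_has_winning_strategy \/ GS_two_has_winning_strategy.

End GaleStewart.

Definition D (L K : Type) : Prop :=
  forall A : set (nat -> L), GS_determined K A.

(* An alias of [K -> X], to avoid the topologies that the library already puts
   on function types. *)
Definition box_power (K : Type) (X : Type) : Type := K -> X.

Section BoxTopology.
Variables (K : Type) (X : topologicalType).

Definition box (U : K -> set X) : set (box_power K X) :=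
  [set f | forall a, U a (f a)].

Definition open_factors : set (K -> set X) := [set U | forall a, open (U a)].

HB.instance Definition _ := Choice.copy (box_power K X) (K -> X).

Lemma box_cover : \bigcup_(U in open_factors) box U = setT.
Proof.
apply/seteqP; split=> // f _; exists (fun=> setT) => // a.
exact: openT.
Qed.

Lemma box_join (U V : K -> set X) (f : box_power K X) :
  open_factors U -> open_factors V -> box U f -> box V f ->
  exists W, [/\ open_factors W, box W f & box W `<=` box U `&` box V].
Proof.
move=> oU oV Uf Vf; exists (fun a => U a `&` V a); split.
- by move=> a; apply: openI; [exact: oU | exact: oV].
- by move=> a; split.
- by move=> g UVg; split=> a; have [] := UVg a.
Qed.

HB.instance Definition _ :=
  isBaseTopological.Build (box_power K X) box_cover box_join.

End BoxTopology.

Definition baire_space (X : topologicalType) : Prop :=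
  forall F : set (set X), countable F ->
    (forall U, F U -> open U /\ dense U) -> dense (\bigcap_(U in F) U).

Definition pi_base (X : topologicalType) (P : set (set X)) : Prop :=
  (forall U, P U -> open U /\ U !=set0) /\
  (forall U, open U -> U !=set0 -> exists2 V, P V & V `<=` U).

(* The pi-weight, i.e. the least cardinality of a pi-base, is at most |L|. *)
Definition pi_weight_le (X : topologicalType) (L : Type) : Prop :=
  exists2 P : set (set X), pi_base P & P #<= [set: L].

Section BanachMazur.
Variable X : topologicalType.

(* The default value setT of [last] makes the first move an arbitrary nonempty
   open set. *)
Definition BM_legal_move (h : seq (set X)) (U : set X) : Prop :=
  [/\ open U, U !=set0 & U `<=` last setT h].

(* White's moves are the B (2n), Black's the B (2n+1).  A strategy of Black has
   to answer every legal position by a legal move; this is required at finite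
   positions, because after an empty answer no infinite legal play exists. *)
Definition BM_black_strategy (s : seq (set X) -> set X) : Prop :=
  forall (B : nat -> set X) (n : nat),
    (forall k, (k < n.*2.+1)%N -> BM_legal_move (mkseq B k) (B k)) ->
    BM_legal_move (mkseq B n.*2.+1) (s (mkseq B n.*2.+1)).

Definition BM_black_has_winning_strategy : Prop :=
  exists2 s : seq (set X) -> set X, BM_black_strategy s &
    forall B : nat -> set X,
      (forall n, BM_legal_move (mkseq B n) (B n)) ->
      (forall n, B n.*2.+1 = s (mkseq B n.*2.+1)) ->
      \bigcap_n B n !=set0.

End BanachMazur.

Definition B (L K : Type) : Prop :=
  forall X : topologicalType, pi_weight_le X L ->
    baire_space (box_power K X) -> BM_black_has_winning_strategy X.

(* Main.v *)
Require Import Defs.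
From mathcomp Require Import all_boot.
From mathcomp Require Import boolp classical_sets functions cardinality.
From mathcomp Require Import topology_structure.

Set Implicit Arguments.
Unset Strict Implicit.
Unset Printing Implicit Defensive.

Local Open Scope classical_set_scope.
Local Open Scope card_scope.

(** Moves of the multiboard game are made to code moves of the Banach-Mazur
    game.  Since [X] has a pi-base of size at most [|L|], a letter [l : L] can
    be read, relative to any nonempty open [U], as a nonempty open subset
    [r U l] of [U], in such a way that every nonempty open subset of [U]
    includes some [r U l] ([pi_weight_refinement]).  Starting from the whole
    space, an infinite word over [L] thus codes a decreasing sequence of
    nonempty open sets; no word is illegal.  The payoff set [A] consists of the
    words whose sequence has empty intersection, so that on each board ONE
    plays White and TWO plays Black.  By hypothesis one of the players has a
    winning strategy.

    Suppose that it is TWO.  Black imagines a play of the multiboard game in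
    which ONE moves identically on all boards, translates White's sets into
    letters that code smaller sets, and copies TWO's answers on one fixed
    board.  As TWO wins on every board, the intersection is nonempty
    ([black_wins_of_two_wins]).

    Suppose that it is ONE.  A position of the multiboard game determines an
    open box, the product of the sets coded on the boards, and TWO can bring
    the play inside any given nonempty open subset of the current box.
    If the power is Baire, then TWO can play so that the boxes have a common
    point ([baire_branch], the argument of Oxtoby that White has no winning
    strategy on a Baire space), and the coordinates of that point show that ONE
    wins on no board: a contradiction ([one_does_not_win]). *)

(** * Plays *)

(** The move following each position determines the play; both halves of the
    proof build plays in this way, merging a given strategy with the moves of
    its opponent. *)
Section Run.
Variables (T : Type) (next : seq T -> T).

Fixpoint run (n : nat) : seq T :=
  if n is m.+1 then rcons (run m) (next (run m)) else [::].

Definition run_move (n : nat) : T := next (run n).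

Lemma mkseq_run n : mkseq run_move n = run n.
Proof. by elim: n => // n IHn; rewrite mkseqS IHn. Qed.

Lemma size_run n : size (run n) = n.
Proof. by rewrite -mkseq_run size_mkseq. Qed.

End Run.

Lemma eq_run T (next next' : seq T -> T) n :
  (forall q, (size q < n)%N -> next q = next' q) -> run next n = run next' n.
Proof.
elim: n => //= n IHn eqn; rewrite IHn ?eqn ?size_run // => q qn.
exact/eqn/(ltn_trans qn).
Qed.

(** * Choosing a branch in a Baire space *)

(** At each node [q] a maximal disjoint subfamily of the sets
    [V (step q g)] is kept.  By density of the sets [V (step q g)] below [V q]
    its union is dense in [V q], and by disjointness a point of [V q] lies in
    at most one member, so that every point follows a single branch.  Hence the
    points that remain in the chosen sets for [n] steps form a dense open subset
    of [V q0], and a point that does so for every [n] yields the branch. *)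
Lemma baire_branch (Y : topologicalType) (S G : Type) (V : S -> set Y)
    (step : S -> G -> S) (q0 : S) :
  baire_space Y ->
  (forall q, open (V q)) -> (forall q, V q !=set0) ->
  (forall q g, V (step q g) `<=` V q) ->
  (forall q O, open O -> O !=set0 -> O `<=` V q ->
    exists g, V (step q g) `<=` O) ->
  exists (g : nat -> G) (q : nat -> S),
    [/\ q 0 = q0, forall n, q n.+1 = step (q n) (g n) &
        \bigcap_n V (q n) !=set0].
Proof.
move=> baireY Vopen Vneq0 Vsub Vdense.
have [g0 _] := Vdense q0 _ (Vopen q0) (Vneq0 q0) (@subset_refl _ _).
have /choice[M Mmax] : forall q, exists M : set G,
    trivIset M (fun g => V (step q g)) /\
    forall g, exists2 g', M g' & V (step q g) `&` V (step q g') !=set0.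
  move=> q; have [M [_ trivM maxM]] :=
    ex_maximal_disjoint_subcollection (fun g => V (step q g)) setT.
  exists M; split=> // g; apply: contrapT => noMg.
  have gV : forall g', M g' -> ~ (V (step q g) `&` V (step q g') !=set0).
    by move=> g' Mg' gg'; apply: noMg; exists g'.
  apply: (maxM (M `|` [set g])) => //.
    split; first exact: subsetUl.
    move=> /(_ g (or_intror erefl)) /gV; rewrite setIid; apply; exact: Vneq0.
  move=> i j [Mi|->] [Mj|->] // ij; first exact: trivM.
  - by case: (gV _ Mi); rewrite setIC.
  - by case: (gV _ Mj).
have /choice[next nextP] : forall yq : Y * S, exists g,
    (exists2 g', M yq.2 g' & V (step yq.2 g') yq.1) ->
    M yq.2 g /\ V (step yq.2 g) yq.1.
  move=> [y q] /=; have [[g' Mg' yg']|no] :=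
    pselect (exists2 g', M q g' & V (step q g') y); first by exists g'.
  by exists g0 => /no.
pose branch y n := iter n (fun q => step q (next (y, q))) q0.
pose stays n := [set y | forall i, (i <= n)%N -> V (branch y i) y /\
   ((i < n)%N -> M (branch y i) (next (y, branch y i)))].
(* Disjointness: two points in the same chosen set have the same history. *)
have branch_eq n y z : stays n y -> V (branch y n) z ->
    branch z n = branch y n /\ stays n z.
  elim: n => [|n IHn] yn zn.
    by split=> // i; rewrite leqn0 => /eqP->; split.
  have yn' : stays n y.
    move=> i ni; have [Vi Mi] := yn i (leqW ni).
    by split=> // lin; apply: Mi; apply: leqW.
  have [eqn zn'] := IHn yn' (Vsub _ _ _ zn).
  have [_ /(_ (ltnSn n)) Mn] := yn n (leqnSn n).
  have [Mz Vz] : M (branch y n) (next (z, branch y n)) /\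
                 V (step (branch y n) (next (z, branch y n))) z.
    apply: (nextP (z, branch y n)); exists (next (y, branch y n)) => //.
  have eqg : next (z, branch y n) = next (y, branch y n).
    by have [trivM _] := Mmax (branch y n); apply: trivM => //; exists z.
  have eqSn : branch z n.+1 = branch y n.+1.
    by rewrite /branch !iterS -!/(branch _ _) eqn eqg.
  split=> // i; rewrite leq_eqVlt => /predU1P[->|ilt].
    by rewrite eqSn ltnn.
  have [Vi Mi] := zn' i ilt; split=> // _.
  move: ilt; rewrite ltnS leq_eqVlt => /predU1P[->|/Mi//].
  by rewrite eqn eqg.
have stays_open n : open (stays n).
  rewrite openE => y yn; rewrite /interior.
  apply: (filterS (P := V (branch y n))); last first.
    by apply: open_nbhs_nbhs; split=> //; have [] := yn n (leqnn n).
  by move=> z /(branch_eq n y z yn)[].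
have stays_dense n O : open O -> O !=set0 -> O `<=` V q0 ->
    O `&` stays n !=set0.
  move=> Oopen On0 Osub; elim: n => [|n [y [Oy yn]]].
    have [y Oy] := On0; exists y; split=> // i; rewrite leqn0 => /eqP->.
    by split=> //; exact: Osub.
  have Vy : V (branch y n) y by have [] := yn n (leqnn n).
  have [|||g gsub] := Vdense (branch y n) (O `&` V (branch y n)).
  - exact: openI.
  - by exists y.
  - by move=> z [].
  have [_ /(_ g)[g' Mg' [z [zg zg']]]] := Mmax (branch y n).
  have [Oz Vz] := gsub _ zg.
  have [eqn zn] := branch_eq n y z yn Vz.
  have [Mz Vz'] : M (branch z n) (next (z, branch z n)) /\
                  V (step (branch z n) (next (z, branch z n))) z.
    by apply: (nextP (z, branch z n)); exists g'; rewrite /= eqn.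
  exists z; split=> // i; rewrite leq_eqVlt => /predU1P[->|ilt].
    by rewrite ltnn; split.
  have [Vi Mi] := zn i ilt; split=> // _.
  by move: ilt; rewrite ltnS leq_eqVlt => /predU1P[->|/Mi].
(* The exterior of [V q0] is added to get sets that are dense everywhere. *)
pose E n := stays n `|` (~` V q0)°.
have [|_ [n _ <-]|y [Vy Ey]] := baireY (range E) _ _ _ (Vneq0 q0) (Vopen q0).
- exact: card_image_le.
- split; first by apply: openU => //; exact: open_interior.
  move=> O On0 Oopen; have [OV|OV] := pselect (O `&` V q0 !=set0).
    have [|y [[Oy _] yn]] := stays_dense n _ (openI Oopen (Vopen q0)) OV.
      exact: subIsetr.
    by exists y; split=> //; left.
  have [y Oy] := On0; exists y; split=> //; right.
  apply: (filterS (P := O)); last by apply: open_nbhs_nbhs; split.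
  by move=> z Oz Vz; apply: OV; exists z.
exists (fun n => next (y, branch y n)), (branch y); split=> //.
exists y => n _; have [|yn|/interior_subset/(_ Vy)//] := Ey (E n).
  by exists n.
by have [] := yn n (leqnn n).
Qed.

(** * Coding open sets by letters *)

Definition codes_below (X : topologicalType) (L : Type) (U : set X)
    (c : L -> set X) : Prop :=
  (forall l, [/\ open (c l), c l !=set0 & c l `<=` U]) /\
  (forall W, open W -> W !=set0 -> W `<=` U -> exists l, c l `<=` W).

(** A letter is read as the corresponding member of the pi-base when that member
    lies in [U], and as a fixed member below [U] otherwise; this is what keeps
    every word legal. *)
Lemma pi_weight_refinement (X : topologicalType) (L : Type) :
  pi_weight_le X L ->
  exists r : set X -> L -> set X,
    forall U, open U -> U !=set0 -> codes_below U (r U).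
Proof.
move=> [P [Popen Pbase] /pcard_surjP[e eP]].
suff /choice[r rP] : forall U, exists c : L -> set X,
    open U -> U !=set0 -> codes_below U c by exists r.
move=> U.
have [[Uopen Un0]|noU] := pselect (open U /\ U !=set0); last first.
  by exists (fun=> setT) => ? ?; case: noU.
have [V0 PV0 V0U] := Pbase U Uopen Un0.
exists (fun l => if `[< P (e l) /\ e l `<=` U >] then e l else V0) => _ _; split.
  move=> l; case: asboolP => [[Pel elU]|_].
    by have [] := Popen _ Pel; split.
  by have [] := Popen _ PV0; split.
move=> W Wopen Wn0 WU; have [V PV VW] := Pbase W Wopen Wn0.
have [l _ el] := eP V PV; exists l.
by rewrite el asboolT //; split=> //; exact: subset_trans WU.
Qed.

Lemma open_box (K : Type) (X : topologicalType) (U : K -> set X) :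
  (forall a, open (U a)) -> open (box U).
Proof.
move=> Uopen; exists [set U]; first by move=> _ ->.
exact: bigcup_set1.
Qed.

Lemma box_base (K : Type) (X : topologicalType) (O : set (box_power K X)) f :
  open O -> O f ->
  exists U : K -> set X, [/\ forall a, open (U a), box U f & box U `<=` O].
Proof.
move=> [F Fopen <-] [U FU Uf]; exists U; split=> //; first exact: Fopen.
by move=> g Ug; exists U.
Qed.

Section Coding.
Variables (X : topologicalType) (L K : Type) (r : set X -> L -> set X).
Hypothesis X_inh : [set: X] !=set0.
Hypothesis r_codes : forall U, open U -> U !=set0 -> codes_below U (r U).

Definition coded (w : seq L) : set X := foldl r setT w.

Definition board (a : K) (q : seq (K -> L)) : set X := coded [seq f a | f <- q].

Definition empty_words : set (nat -> L) :=
  [set x | \bigcap_n coded (mkseq x n) = set0].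

Lemma coded_rcons w l : coded (rcons w l) = r (coded w) l.
Proof. exact: foldl_rcons. Qed.

Lemma board_rcons a q f : board a (rcons q f) = r (board a q) (f a).
Proof. by rewrite /board map_rcons coded_rcons. Qed.

Lemma coded_mkseq (f : nat -> K -> L) a n :
  coded (mkseq (fun n => f n a) n) = board a (mkseq f n).
Proof. by rewrite /board /mkseq -map_comp. Qed.

Lemma board_open_neq0 a q : open (board a q) /\ board a q !=set0.
Proof.
elim/last_ind: q => [|q f [qo qn]]; first by split=> //; exact: openT.
by rewrite board_rcons; have [] := (r_codes qo qn).1 (f a).
Qed.

Lemma board_rcons_sub a q f : board a (rcons q f) `<=` board a q.
Proof.
rewrite board_rcons; have [qo qn] := board_open_neq0 a q.
by have [] := (r_codes qo qn).1 (f a).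
Qed.

(** * Transferring winning strategies *)

(** The boards are coded independently, so TWO may aim at a separate open
    subset on each of them; this is what makes the box topology the right one. *)
Lemma one_does_not_win :
  baire_space (box_power K X) ->
  ~ GS_one_has_winning_strategy K empty_words.
Proof.
move=> baireX [s s_wins].
pose V (q : seq (K -> L)) : set (box_power K X) := box (fun a => board a q).
pose step q g := let q' := rcons q g in rcons q' (s q').
have [||||g [q [q0 qS [y Vy]]]] := @baire_branch _ _ _ V step [:: s [::]] baireX.
- by move=> q; apply: open_box => a; have [] := board_open_neq0 a q.
- move=> q.
  have /choice[y Vy] : forall a, exists x, board a q x.
    by move=> a; have [_ [x]] := board_open_neq0 a q; exists x.
  by exists y.
- by move=> q g y yV a; do 2!apply: board_rcons_sub; exact: yV.
- move=> q O Oopen [y Oy] OV.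
  have [U [Uopen Uy UO]] := box_base Oopen Oy.
  have /choice[g gU] : forall a, exists l, r (board a q) l `<=` U a.
    move=> a; have [qo qn] := board_open_neq0 a q.
    have [|||l lU] := (r_codes qo qn).2 (U a `&` board a q).
    - exact: openI.
    - by exists (y a); split; [exact: Uy | exact: OV].
    - exact: subIsetr.
    by exists l => x /lU[].
  exists g => z zV; apply: UO => a; apply: gU; rewrite -board_rcons.
  exact/board_rcons_sub/zV.
pose next p := if odd (size p) then g (size p)./2 else s p.
have run_q n : run next n.*2.+1 = q n.
  elim: n => [|n IHn]; first by rewrite q0.
  rewrite doubleS [LHS]/= -[rcons (run next n.*2) _]/(run next n.*2.+1) qS -IHn.
  set p := run next n.*2.+1.
  have -> : next p = g n by rewrite /next size_run /= odd_double uphalf_double.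
  by rewrite {1}/next size_rcons size_run /= odd_double.
have [|a] := s_wins (run_move next).
  by move=> n; rewrite mkseq_run /run_move /next size_run odd_double.
apply/eqP/set0P; exists (y a) => n _.
rewrite coded_mkseq mkseq_run.
(* The sets coded on a board decrease, so the position after [n.*2.+1] moves,
   whose box is [V (q n)], bounds the one after [n] moves. *)
have : V (q n) y by exact: Vy.
rewrite -run_q => /(_ a).
have: (n <= n.*2.+1)%N by rewrite -addnn -addnS leq_addr.
elim: (n.*2.+1) => [|m IHm]; first by rewrite leqn0 => /eqP->.
rewrite leq_eqVlt => /predU1P[<- //|nm ym].
by apply: IHm => //; exact: board_rcons_sub ym.
Qed.

(** A strategy must also answer legally at positions that it cannot reach, where
    the imagined play is unrelated to the sets on the table; there Black repeats
    White's last set. *)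
Lemma black_wins_of_two_wins (a : K) :
  GS_two_has_winning_strategy K empty_words -> BM_black_has_winning_strategy X.
Proof.
move=> [s s_wins].
have /choice[code codeP] : forall UW : set X * set X, exists l,
    open UW.1 -> UW.1 !=set0 -> open UW.2 -> UW.2 !=set0 -> UW.2 `<=` UW.1 ->
    r UW.1 l `<=` UW.2.
  move=> [U W] /=.
  have [[Uo Un Wo Wn WU]|no] := pselect [/\ open U, U !=set0, open W,
                                           W !=set0 & W `<=` U].
    by have [l lW] := (r_codes Uo Un).2 W Wo Wn WU; exists l.
  (* Any letter will do here; the strategy [s] provides one. *)
  by exists (s [::] a) => *; case: no.
have {}codeP U W : open U -> U !=set0 -> open W -> W !=set0 -> W `<=` U ->
    r U (code (U, W)) `<=` W by exact: codeP (U, W).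
pose next (B : nat -> set X) q :=
  if odd (size q) then s q else fun=> code (board a q, B (size q)).
pose reply (h : seq (set X)) :=
  let R := board a (run (next (nth setT h)) (size h).+1) in
  if `[< R `<=` last setT h >] then R else last setT h.
have last_mkseq (B : nat -> set X) n : last setT (mkseq B n.+1) = B n.
  by rewrite mkseqS last_rcons.
exists reply => [B n Bleg|B Bleg Brep].
  have [Bo Bn _] := Bleg n.*2 (ltnSn _).
  rewrite /BM_legal_move /reply last_mkseq; case: asboolP => [RB|_]; last by split.
  by have [Ro Rn] := board_open_neq0 a
    (run (next (nth setT (mkseq B n.*2.+1))) (size (mkseq B n.*2.+1)).+1).
pose p := run (next B).
(* Whenever White is to move, the imagined play has coded Black's last set,
   or the whole space at the start. *)
have inv n : board a (p n.*2) = last setT (mkseq B n.*2) /\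
    board a (p n.+1.*2) = B n.*2.+1 /\ B n.*2.+1 `<=` B n.*2.
  suff step m : board a (p m.*2) = last setT (mkseq B m.*2) ->
      board a (p m.+1.*2) = B m.*2.+1 /\ B m.*2.+1 `<=` B m.*2.
    suff {}inv : board a (p n.*2) = last setT (mkseq B n.*2).
      by split=> //; exact: step.
    by elim: n => // n /step[-> _]; rewrite doubleS last_mkseq.
  move=> eqm; have [Bo Bn Bsub] := Bleg m.*2.
  have subR : board a (p m.+1.*2) `<=` B m.*2.
    rewrite doubleS; apply: subset_trans (@board_rcons_sub _ _ _) _.
    rewrite board_rcons {2}/next size_run odd_double.
    have [qo qn] := board_open_neq0 a (p m.*2).
    by apply: codeP => //; rewrite eqm.
  have eqB : B m.*2.+1 = board a (p m.+1.*2).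
    rewrite Brep /reply last_mkseq size_mkseq.
    (* The imagined play uses only the sets that are already on the table. *)
    have -> : run (next (nth setT (mkseq B m.*2.+1))) m.*2.+2 = p m.+1.*2.
      rewrite doubleS; apply: eq_run => q; rewrite ltnS leq_eqVlt /next.
      by case/predU1P => [->|qm]; [rewrite /= odd_double | rewrite nth_mkseq].
    by rewrite asboolT.
  by rewrite eqB.
have : ~ GS_one_wins empty_words (run_move (next B)).
  apply: s_wins => n.
  by rewrite mkseq_run /run_move {1}/next size_run /= odd_double.
move=> no1; have /eqP/set0P[x xB] : ~ empty_words (fun n => run_move (next B) n a).
  by move=> Aa; apply: no1; exists a.
have xodd n : B n.*2.+1 x.
  have [_ [<- _]] := inv n.
  by have := xB n.+1.*2 I; rewrite coded_mkseq mkseq_run.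
exists x => n _; rewrite -[n]odd_double_half; case: (odd n) => /=.
  exact: xodd.
by have [_ [_]] := inv n./2; apply; exact: xodd.
Qed.

End Coding.

Lemma black_wins_empty (X : topologicalType) :
  ~ ([set: X] !=set0) -> BM_black_has_winning_strategy X.
Proof.
move=> X0; exists (fun=> setT) => [B n /(_ 0 isT)|B /(_ 0)] [_ [x _] _].
  by case: X0; exists x.
by case: X0; exists x.
Qed.

Theorem theorem4 (L K : Type) (hL : `I_2 #<= [set: L]) (hK : `I_1 #<= [set: K]) :
  D L K -> B L K.
Proof.
move=> det X /pi_weight_refinement[r rP] baireX.
have [X_inh|/black_wins_empty//] := pselect ([set: X] !=set0).
have [one|two] := det (empty_words r).
  by case: (one_does_not_win X_inh rP baireX).
have [f] := card_leP hK.
have lt01 : `I_1 0 by [].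
exact: black_wins_of_two_wins X_inh rP (val (f (SigSub (mem_set lt01)))) two.
Qed.
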